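(* Let $F_{3,2}$ be the $3$-graph on vertex set $\{1,2,3,4,5\}$ with $3$-edges $123, 145, 245, 345$. For every positive integer $n$, $$\mathrm{co^+ex}(n,F_{3,2})\le \frac n2 .$$ Moreover, if $H$ is an $F_{3,2}$-free $n$-vertex $3$-graph with $\delta_2^+(H)=n/2$, then $n$ is divisible by $4$ and $H$ is the complete balanced $4$-partite $3$-graph.
   Context: A $3$-graph is a finite $3$-uniform hypergraph; an edge is written as the concatenation of its vertices. The minimum positive co-degree $\delta_2^+(H)$ of a non-empty $3$-graph $H$ is the maximum $k$ such that every pair of vertices contained in some edge of $H$ is contained in at least $k$ distinct edges of $H$; by convention it is $0$ if $H$ has no edges. A hypergraph is $F$-free if it has no (not necessarily induced) subhypergraph isomorphic to $F$. $\mathrm{co^+ex}(n,F)$ is the maximum of $\delta_2^+(H)$ over all $n$-vertex $F$-free $3$-graphs $H$. The complete balanced $4$-partite $3$-graph on $n$ vertices has its vertex set partitioned into four classes whose sizes differ by at most $1$, and its edges are all triples meeting each class in at most one vertex. *)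

(* Defs.v *)
From HB Require Import structures.
From mathcomp Require Import all_boot all_order all_algebra.

Set Implicit Arguments.
Unset Strict Implicit.
Unset Printing Implicit Defensive.

Definition uniform3 (T : finType) (E : {set {set T}}) : bool :=
  [forall e in E, #|e| == 3].

(* The vertex set is all of T, so isolated vertices count. *)
Record graph3 (T : finType) := Graph3 {
  edges : {set {set T}};
  _ : uniform3 edges
}.

HB.instance Definition _ (T : finType) := [isSub for @edges T].
HB.instance Definition _ (T : finType) := [Finite of graph3 T by <:].

Definition codeg (T : finType) (H : graph3 T) (p : {set T}) : nat :=
  #|[set e in edges H | p \subset e]|.

Definition covered_pair (T : finType) (H : graph3 T) (p : {set T}) : bool :=
  (#|p| == 2) && [exists e in edges H, p \subset e].

(* When H has an edge, some pair is covered, so every k satisfying the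
   condition is at most #|edges H|: the bound on k excludes no value. *)
Definition pos_codeg (T : finType) (H : graph3 T) : nat :=
  if edges H == set0 then 0
  else \max_(k < #|edges H|.+1
             | [forall p : {set T}, covered_pair H p ==> (k <= codeg H p)]) k.

(* The images of the vertices and edges of F under f form the copy of F in H. *)
Definition contains (U T : finType) (F : graph3 U) (H : graph3 T) : bool :=
  [exists f : {ffun U -> T},
    injectiveb f && [forall e in edges F, f @: e \in edges H]].

Definition is_free (U T : finType) (F : graph3 U) (H : graph3 T) : bool :=
  ~~ contains F H.

Definition co_pos_ex (n : nat) (U : finType) (F : graph3 U) : nat :=
  \max_(H : graph3 'I_n | is_free F H) pos_codeg H.

(* The vertices 1, ..., 5 are the ordinals 0, ..., 4 of 'I_5. *)
Definition vset5 (s : seq nat) : {set 'I_5} := [set x : 'I_5 | x.+1 \in s].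

Definition F32_edges : {set {set 'I_5}} :=
  [set vset5 [:: 1; 2; 3]; vset5 [:: 1; 4; 5];
       vset5 [:: 2; 4; 5]; vset5 [:: 3; 4; 5]].

Lemma F32_uniform : uniform3 F32_edges.
Proof.
apply/forall_inP => e; rewrite !inE -!orbA => /or4P[] /eqP->;
by rewrite cardsE -sum1_card big_mkcond !big_ord_recl big_ord0.
Qed.

Definition F32 : graph3 'I_5 := Graph3 F32_uniform.

Definition color_class (T : finType) (c : T -> 'I_4) (i : 'I_4) : {set T} :=
  [set x | c x == i].

Definition is_complete_balanced_4partite (T : finType) (H : graph3 T) : Prop :=
  exists c : T -> 'I_4,
    (forall i j : 'I_4, #|color_class c i| <= #|color_class c j| + 1) /\
    edges H =
      [set e : {set T} | (#|e| == 3)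
                         && [forall i : 'I_4, #|e :&: color_class c i| <= 1]].

(* Main.v *)
(* A 3-graph is F32-free iff no neighbourhood N(x, y) contains an edge.  Let
   uvw be an edge, n <= 2k where k is the positive co-degree, and A = N(u, v).
   As u lies in neither A nor N(u, w), the set N(u, w) meets A in some t, and
   N(w, t) avoids A by F32-freeness; counting gives n = 2k and
   N(w, t) = ~: A.  So A and B = ~: A play the same role, both span no edge,
   and the covered pairs inside A (resp. B) form a triangle-free graph.  The
   neighbourhood N(a, b) is the disjoint union of N_A(a) and N_B(b), so both
   graphs are regular, of degrees summing to k; triangle-freeness bounds each
   degree by k / 2, so both graphs are complete balanced bipartite. *)
Require Import Defs.
From mathcomp Require Import all_boot all_order all_algebra.
From mathcomp Require Import zify.

Set Implicit Arguments.
Unset Strict Implicit.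
Unset Printing Implicit Defensive.

(** * Regular triangle-free graphs on a vertex set [A] *)

Section TriangleFreeRegular.

Variables (T : finType) (A : {set T}) (D : T -> {set T}) (d : nat).
Hypothesis D_sub : forall x, x \in A -> D x \subset A.
Hypothesis D_card : forall x, x \in A -> #|D x| = d.
Hypothesis D_triangle_free :
  forall x y, x \in A -> y \in D x -> [disjoint D x & D y].

(** Adjacent vertices have disjoint neighbourhoods, each of size [d] and contained in [A]. *)
Lemma triangle_free_regular_degree x y : x \in A -> y \in D x -> 2 * d <= #|A|.
Proof.
move=> xA yDx; have yA : y \in A by apply: (subsetP (D_sub xA)).
have := leq_card_setU (D x) (D y); rewrite (D_triangle_free xA yDx) => -[_ /eqP].
rewrite !D_card // mul2n -addnn => <-.
by apply: subset_leq_card; rewrite subUset !D_sub.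
Qed.

Lemma triangle_free_nbhd x y :
  #|A| = 2 * d -> x \in A -> y \in D x -> D y = A :\: D x.
Proof.
move=> cA xA yDx; have yA : y \in A by apply: (subsetP (D_sub xA)).
apply/eqP; rewrite eqEcard subsetD D_sub // disjoint_sym D_triangle_free //=.
by rewrite cardsD (setIidPr (D_sub xA)) !D_card // cA mul2n -addnn addnK.
Qed.

(** When [#|A| = 2 * d], the neighbourhood of a vertex is the complement in [A] of that of any
    neighbour. Hence the parts are [D a] and [D a' = A :\: D a], and each vertex is joined to the
    whole opposite part. *)
Lemma triangle_free_complete_bipartite a a' x y :
  #|A| = 2 * d -> a \in A -> a' \in D a -> x \in A -> y \in A ->
  (y \in D x) = ((x \in D a) != (y \in D a)).
Proof.
move=> cA aA a'Da xA yA; have a'A : a' \in A by apply: (subsetP (D_sub aA)).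
have Da' := triangle_free_nbhd cA aA a'Da.
have [xDa | xDa] := boolP (x \in D a).
  by rewrite (triangle_free_nbhd cA aA xDa) inE yA andbT.
have xDa' : x \in D a' by rewrite Da' inE xDa.
rewrite (triangle_free_nbhd cA a'A xDa') Da' !inE yA !andbT negbK.
by case: (y \in D a).
Qed.

End TriangleFreeRegular.

(** * Symmetric ternary relations whose neighbourhoods span no edge *)

Section NeighbourhoodsSpanNoEdge.

Variables (T : finType) (tri : T -> T -> T -> bool) (k : nat).
Hypothesis tri_swap12 : forall x y z, tri x y z = tri y x z.
Hypothesis tri_swap23 : forall x y z, tri x y z = tri x z y.
Hypothesis tri_irr : forall x z, ~~ tri x x z.
Hypothesis nbhd_free :
  forall u v x y z, tri u v x -> tri u v y -> tri u v z -> ~~ tri x y z.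

Definition nbhd x y := [set z | tri x y z].

Hypothesis nbhd_card : forall x y z, tri x y z -> k <= #|nbhd x y|.
Hypothesis card_le : #|T| <= 2 * k.

(** Freeness makes [nbhd x y] and [nbhd u v] disjoint; each has at least [k] of the at most [2 * k]
    vertices, so they partition [T]. *)
Lemma nbhd_complement u v x y z :
  x \in nbhd u v -> y \in nbhd u v -> tri x y z ->
  [/\ #|T| = 2 * k, #|nbhd u v| = k & nbhd x y = ~: nbhd u v].
Proof.
rewrite !inE => ux uy xyz.
have sub : nbhd x y \subset ~: nbhd u v.
  apply/subsetP => t; rewrite !inE => xyt; apply/negP => uvt.
  by move: xyt; apply/negP; apply: nbhd_free uvt.
have := subset_leq_card sub; have := nbhd_card xyz; have := nbhd_card ux.
have := cardsC (nbhd u v) => C1 C2 C3 C4; split; try lia.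
by apply/eqP; rewrite eqEcard sub /=; lia.
Qed.

Lemma tri_rot x y z : tri x y z = tri y z x.
Proof. by rewrite tri_swap12 tri_swap23. Qed.

(** Otherwise [nbhd u v], [nbhd u w] and [[set u]] would be pairwise disjoint, which takes at least
    [2 * k + 1] vertices. *)
Lemma nbhd_partner u v w :
  w \in nbhd u v -> exists2 t, t \in nbhd u v & tri w t u.
Proof.
rewrite inE => uvw; apply/exists_inP; apply: contraT => /exists_inPn no_t.
have sub : nbhd u w \subset ~: (u |: nbhd u v).
  apply/subsetP => t; rewrite !inE => uwt; apply/negP => /orP[/eqP tu | uvt].
    by move: uwt; rewrite tu tri_swap23 (negbTE (tri_irr _ _)).
  by have := no_t t; rewrite inE -(tri_rot u) uwt => /(_ uvt).
have := subset_leq_card sub; have := cardsC (u |: nbhd u v).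
rewrite cardsU1 inE tri_swap23 (negbTE (tri_irr _ _)) /=.
have := nbhd_card uvw; rewrite tri_swap23 in uvw; have := nbhd_card uvw.
by move: #|T| #|~: _| #|nbhd u w| #|nbhd u v| card_le; clear; lia.
Qed.

Lemma card_nbhd u v w : tri u v w -> #|T| = 2 * k /\ #|nbhd u v| = k.
Proof.
move=> uvw; have uw : w \in nbhd u v by rewrite inE.
have [t ut wtu] := nbhd_partner uw.
by case: (nbhd_complement uw ut wtu).
Qed.

(** Gathers what [nbhd u v] and its complement have in common, so that each later statement about
    one of them applies to the other. *)
Definition side (A : {set T}) : Prop :=
  [/\ #|A| = k,
      forall x y z, x \in A -> y \in A -> tri x y z -> nbhd x y = ~: A
    & forall x, x \in A -> exists2 y, y \in A & nbhd x y = ~: A].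

Lemma nbhd_side u v w : tri u v w -> side (nbhd u v).
Proof.
move=> uvw; split; first by case: (card_nbhd uvw).
  by move=> x y z xA yA xyz; case: (nbhd_complement xA yA xyz).
move=> x xA; have [t tA xtu] := nbhd_partner xA; exists t => //.
by case: (nbhd_complement xA tA xtu).
Qed.

(** The complement is itself a neighbourhood, namely [nbhd w t] for the [t] given by
    [nbhd_partner]. *)
Lemma nbhd_sideC u v w : tri u v w -> side (~: nbhd u v).
Proof.
move=> uvw; have wA : w \in nbhd u v by rewrite inE.
have [t tA wtu] := nbhd_partner wA.
by have [_ _ <-] := nbhd_complement wA tA wtu; apply: nbhd_side wtu.
Qed.

(** The neighbourhood of [x] in the graph of covered pairs inside [A]: on a side with nonempty
    complement, a pair is covered exactly when its neighbourhood is [~: A]. *)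
Definition inner (A : {set T}) x : {set T} := [set y in A | nbhd x y == ~: A].

Lemma inner_sub (A : {set T}) x : inner A x \subset A.
Proof. by apply/subsetP => y; rewrite inE => /andP[]. Qed.

(** Of any three vertices two lie on the same side, so this formula, used for both [A] and [~: A],
    recovers [tri] from the two inner graphs. *)
Lemma side_tri (A : {set T}) x y z :
  side A -> x \in A -> y \in A -> tri x y z = (z \notin A) && (y \in inner A x).
Proof.
move=> [_ sA _] xA yA; rewrite inE yA /=; apply/idP/andP => [xyz | [zA /eqP xy]].
  have xy := sA _ _ _ xA yA xyz; split; last by apply/eqP.
  by rewrite -in_setC -xy inE.
by move: zA; rewrite -in_setC -xy inE.
Qed.

Lemma inner_nonempty (A : {set T}) x : side A -> x \in A -> exists y, y \in inner A x.
Proof.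
by move=> [_ _ sA] xA; have [y yA xy] := sA _ xA; exists y; rewrite inE yA xy eqxx.
Qed.

(** Given a triangle [x], [y], [z] in [A], choose [b'] adjacent to [b] in [~: A]. Then [nbhd x b]
    contains [y], [z] and [b'], which form an edge. *)
Lemma inner_triangle_free (A : {set T}) b x y :
  side A -> side (~: A) -> b \notin A -> x \in A -> y \in inner A x ->
  [disjoint inner A x & inner A y].
Proof.
move=> sA sB bB xA yx; have yA := subsetP (inner_sub A x) _ yx.
rewrite disjoint_subset; apply/subsetP => z zx; have zA := subsetP (inner_sub A x) _ zx.
rewrite !inE; apply/negP => zy; have {}zy : z \in inner A y by rewrite inE.
have bC : b \in ~: A by rewrite inE.
have [b' b'b] := inner_nonempty sB bC; have b'C := subsetP (inner_sub _ b) _ b'b.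
have xby : tri x b y by rewrite tri_swap23 (side_tri _ sA) // bB.
have xbz : tri x b z by rewrite tri_swap23 (side_tri _ sA) // bB.
have xbb' : tri x b b' by rewrite tri_rot (side_tri _ sB) // inE xA.
have := nbhd_free xby xbz xbb'.
by rewrite (side_tri _ sA) // zy -in_setC b'C.
Qed.

(** The [k] elements of [nbhd a b] are the inner neighbours of [a] in [A] and those of [b] in
    [~: A]. *)
Lemma inner_degree_sum (A : {set T}) a b :
  side A -> side (~: A) -> a \in A -> b \notin A ->
  #|inner A a| + #|inner (~: A) b| = k.
Proof.
move=> sA sB aA bB; have bC : b \in ~: A by rewrite inE.
have [y ya] := inner_nonempty sA aA; have yA := subsetP (inner_sub A a) _ ya.
have aby : tri a b y by rewrite tri_swap23 (side_tri _ sA) // bB.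
have [_ <-] := card_nbhd aby.
have -> : nbhd a b = inner A a :|: inner (~: A) b.
  apply/setP => z; rewrite inE inE; have [zA | zB] := boolP (z \in A).
    rewrite tri_swap23 (side_tri _ sA) // bB /=.
    by rewrite [X in _ || X]inE in_setC zA /= orbF.
  have zC : z \in ~: A by rewrite inE.
  by rewrite tri_rot (side_tri _ sB) // !inE aA (negbTE zB).
rewrite cardsU (_ : inner A a :&: inner (~: A) b = set0) ?cards0 ?subn0 //.
by apply/setP => z; rewrite !inE; case: (z \in A); rewrite ?andbF.
Qed.

(** Fixing [b] in the degree sum shows that the inner graph on [A] is regular, so the triangle-free
    bound applies with [#|A| = k]. *)
Lemma inner_degree_le (A : {set T}) a b :
  side A -> side (~: A) -> a \in A -> b \notin A -> 2 * #|inner A a| <= k.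
Proof.
move=> sA sB aA bB; have [y ya] := inner_nonempty sA aA.
have cA : #|A| = k by case: sA.
rewrite -[leqRHS]cA; apply: (triangle_free_regular_degree (D := inner A) _ _ _ aA ya).
- by move=> x _; apply: inner_sub.
- move=> x xA; have := inner_degree_sum sA sB xA bB.
  by rewrite -(inner_degree_sum sA sB aA bB) => /addIn.
- by move=> x x' xA; apply: inner_triangle_free bB xA.
Qed.

(** Both degrees are at most half of [k], and they sum to [k]. *)
Lemma inner_degree (A : {set T}) a b :
  side A -> side (~: A) -> a \in A -> b \notin A -> k = 2 * #|inner A a|.
Proof.
move=> sA sB aA bB; have := inner_degree_sum sA sB aA bB.
have := inner_degree_le sA sB aA bB.
have := @inner_degree_le (~: A) b a sB; rewrite setCK !inE aA bB => /(_ sA isT isT).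
by lia.
Qed.

Lemma inner_complete_bipartite (A : {set T}) a b x y :
  side A -> side (~: A) -> a \in A -> b \notin A -> x \in A -> y \in A ->
  (y \in inner A x) = ((x \in inner A a) != (y \in inner A a)).
Proof.
move=> sA sB aA bB; have [a' a'a] := inner_nonempty sA aA.
apply: (triangle_free_complete_bipartite (d := #|inner A a|) _ _ _ _ aA a'a).
- by move=> z _; apply: inner_sub.
- move=> z zA; have := inner_degree sA sB zA bB.
  by rewrite (inner_degree sA sB aA bB) => /eqP; rewrite eqn_pmul2l // => /eqP.
- by move=> z z' zA; apply: inner_triangle_free bB zA.
- by have [-> _ _] := sA; apply: inner_degree bB.
Qed.

(** The colour of a vertex records its side and its part in the bipartite inner graph of that
    side. *)
Theorem nbhd_free_4partite u v w :
  tri u v w ->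
  exists (c : T -> bool * bool) (d : nat),
    [/\ k = 2 * d, forall p, #|[set x | c x == p]| = d
      & forall x y z, tri x y z = [&& c x != c y, c x != c z & c y != c z]].
Proof.
move=> uvw; set A := nbhd u v.
have sA : side A := nbhd_side uvw; have sB : side (~: A) := nbhd_sideC uvw.
have wA : w \in A by rewrite inE.
have uA : u \notin A by rewrite inE tri_swap23.
have uB : u \in ~: A by rewrite inE.
have wB : w \notin ~: A by rewrite inE wA.
have sA' : side (~: ~: A) by rewrite setCK.
(* [w] and [u] are base points in [A] and [~: A]; the two parts of a side are the inner
   neighbourhood of its base point and the rest. *)
pose h x := x \in if x \in A then inner A w else inner (~: A) u.
pose d := #|inner A w|.
have kA : k = 2 * d := inner_degree sA sB wA uA.
have kB : k = 2 * #|inner (~: A) u| := inner_degree sB sA' uB wB.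
exists (fun x => (x \in A, h x)), d; split=> // [[p q]|x y z].
  have dB : #|inner (~: A) u| = d by lia.
  have card_side (S D : {set T}) b : D \subset S -> #|S| = 2 * #|D| ->
      #|[set x in S | (x \in D) == b]| = #|D|.
    move=> DS cS; case: b.
      congr #|pred_of_set _|; apply/setP => x.
      by rewrite inE eqb_id andb_idl // => /(subsetP DS).
    have := cardsID D S; rewrite (setIidPr DS) cS.
    have -> : [set x in S | (x \in D) == false] = S :\: D.
      by apply/setP => x; rewrite !inE eqbF_neg andbC.
    by lia.
  case: p.
    rewrite -[RHS](card_side A (inner A w) q); last by case: sA => ->.
      apply: eq_card => x.
      by rewrite [LHS]inE [RHS]inE xpair_eqE eqb_id /h; case: (x \in A).
    exact: inner_sub.
  rewrite -dB -(card_side (~: A) (inner (~: A) u) q); last by case: sB => ->.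
    apply: eq_card => x; rewrite [LHS]inE [RHS]inE in_setC xpair_eqE eqbF_neg.
    by rewrite /h; case: (x \in A).
  exact: inner_sub.
have triA s t r : s \in A -> t \in A -> tri s t r = (r \notin A) && (h s != h t).
  move=> sS tS; rewrite (side_tri _ sA) // /h sS tS.
  by rewrite (inner_complete_bipartite sA sB wA uA sS tS).
have triB s t r : s \notin A -> t \notin A -> tri s t r = (r \in A) && (h s != h t).
  move=> sS tS; rewrite (side_tri _ sB) ?in_setC // negbK /h (negbTE sS) (negbTE tS).
  by rewrite (inner_complete_bipartite sB sA' uB wB) ?in_setC.
rewrite !xpair_eqE.
(* If exactly two vertices share a side, [triA] or [triB] decides. If all three do, there is no
   edge, and three boolean values of [h] cannot be pairwise distinct. *)
have [xA|xA] := boolP (x \in A); have [yA|yA] := boolP (y \in A);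
  have [zA|zA] := boolP (z \in A) => /=; rewrite ?andbT.
- by rewrite triA // zA (_ : _ && _ = false) //; move: (h x) (h y) (h z) => [] [] [].
- by rewrite triA // zA.
- by rewrite tri_swap23 triA // yA.
- by rewrite tri_rot triB // xA.
- by rewrite tri_rot triA // xA.
- by rewrite tri_swap23 triB // yA.
- by rewrite triB // zA.
- by rewrite triB // (negbTE zA); move: (h x) (h y) (h z) => [] [] [].
Qed.

End NeighbourhoodsSpanNoEdge.

(** * Passage between 3-graphs and ternary relations *)

Lemma cards3E (T : finType) (x y z : T) :
  (#|[set x; y; z]| == 3) = [&& x != y, x != z & y != z].
Proof.
rewrite setUC cardsU1 cards2 !inE ![z == _]eq_sym.
by case: (x == y); case: (x == z); case: (y == z).
Qed.

Lemma cards3_ex (T : finType) (e : {set T}) :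
  #|e| = 3 -> exists x y z, e = [set x; y; z].
Proof.
move=> e3; have /card_gt0P[x xe] : 0 < #|e| by rewrite e3.
have := cardsD1 x e; rewrite xe e3 => -[/esym/eqP/cards2P[y [z [_ eyz]]]].
by exists x, y, z; rewrite -setUA -eyz setD1K.
Qed.

(** An edge through [x] and [y] is determined by its third vertex. *)
Lemma codeg_le_nbhd (T : finType) (H : graph3 T) x y :
  x != y ->
  codeg H [set x; y] <= #|nbhd (fun x y z => [set x; y; z] \in edges H) x y|.
Proof.
move=> xy; rewrite /codeg; set S := nbhd _ x y.
apply: leq_trans (leq_imset_card (fun z => [set x; y; z]) S).
apply/subset_leq_card/subsetP => e; rewrite inE => /andP[eH xye].
have e3 : #|e| = 3 by apply/eqP; case: H eH {S} => E /= /forall_inP; apply.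
have /cards1P[z ez] : #|e :\: [set x; y]| == 1.
  by rewrite cardsD (setIidPr xye) cards2 xy e3.
have e_xyz : e = [set x; y; z].
  by rewrite -ez -[LHS](setID e [set x; y]) (setIidPr xye).
by apply/imsetP; exists z; rewrite // inE -e_xyz.
Qed.

(** Labels in [r] start at 1 and ordinals at 0, hence the shift [i.-1]. *)
Lemma imset_vset5 (T : finType) (x : T) (s : seq T) (r : seq nat) :
  all (fun i => 0 < i <= 5) r ->
  [set nth x s (val i) | i in vset5 r] = [set t in [seq nth x s i.-1 | i <- r]].
Proof.
move=> /allP r5; apply/setP => t; rewrite inE; apply/imsetP/mapP.
  by move=> [i]; rewrite inE => ir ->; exists i.+1.
move=> [i ir ->]; have /andP[i0 i5] := r5 i ir.
have lt_i : i.-1 < 5 by rewrite prednK.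
by exists (Ordinal lt_i); rewrite ?inE /= ?prednK.
Qed.

(** Vertices 1, 2, 3 go to [x], [y], [z] and vertices 4, 5 to [u], [v]. These are distinct because
    every edge has three elements. *)
Lemma F32_copy (T : finType) (H : graph3 T) u v x y z :
  [set u; v; x] \in edges H -> [set u; v; y] \in edges H ->
  [set u; v; z] \in edges H -> [set x; y; z] \in edges H -> contains F32 H.
Proof.
move=> ux uy uz xz.
have edge3 a b c : [set a; b; c] \in edges H -> [&& a != b, a != c & b != c].
  rewrite -cards3E => abc.
  by case: H abc {ux uy uz xz} => E /= /forall_inP; apply.
pose s := [:: x; y; z; u; v].
have s_uniq : uniq s.
  rewrite /= !inE !negb_or ![_ == u]eq_sym ![_ == v]eq_sym [v == u]eq_sym.
  move: (edge3 _ _ _ ux) (edge3 _ _ _ uy) (edge3 _ _ _ uz) (edge3 _ _ _ xz).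
  move=> /and3P[-> -> ->] /and3P[_ -> ->] /and3P[_ -> ->].
  by move=> /and3P[-> -> ->].
apply/existsP; exists [ffun i : 'I_5 => nth x s i]; apply/andP; split.
  apply/injectiveP => i j; rewrite !ffunE => /eqP.
  by rewrite nth_uniq // => /eqP/val_inj.
have im r : all (fun i => 0 < i <= 5) r ->
    [ffun i : 'I_5 => nth x s i] @: vset5 r = [set t in [seq nth x s i.-1 | i <- r]].
  by move=> r5; rewrite -imset_vset5 //; apply: eq_imset => i; rewrite ffunE.
have set_seq3 a b c : [set t in [:: a; b; c]] = [set a; b; c].
  by apply/setP => t; rewrite !inE orbA.
have rot3 a b c : [set a; b; c] = [set b; c; a] by rewrite -setUA setUC.
apply/forall_inP => e; rewrite !inE -!orbA.
(* The images of 145, 245 and 345 come out with [u] and [v] last; [rot3] moves them to the front. *)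
by move=> /or4P[] /eqP ->; rewrite im //= set_seq3 // rot3.
Qed.

Lemma pos_codeg_le (T : finType) (H : graph3 T) p :
  covered_pair H p -> pos_codeg H <= codeg H p.
Proof.
move=> Hp; rewrite /pos_codeg; case: ifP => // _.
by apply/bigmax_leqP => k /forallP/(_ p)/implyP; apply.
Qed.

Lemma pos_codeg_edge (T : finType) (H : graph3 T) :
  0 < pos_codeg H -> exists u v w, [set u; v; w] \in edges H.
Proof.
rewrite /pos_codeg; case: ifP => // /negbT/set0Pn[e eH] _.
have [u [v [w euvw]]] : exists u v w, e = [set u; v; w].
  by apply: cards3_ex; apply/eqP; case: H eH => E /= /forall_inP; apply.
by exists u, v, w; rewrite -euvw.
Qed.

(** Replaces counting by injectivity of [c] on [e], which can be checked vertex by vertex. *)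
Lemma color_class_le1 (T : finType) (c : T -> 'I_4) (e : {set T}) :
  [forall i, #|e :&: color_class c i| <= 1] =
    [forall x in e, forall y in e, (c x == c y) ==> (x == y)].
Proof.
apply/forallP/forall_inP => [le1 x xe | inj i].
  apply/forall_inP => y ye; apply/implyP => /eqP cxy.
  have /card_le1_eqP le1x := le1 (c x).
  by apply/eqP/le1x; rewrite !inE ?xe ?ye -?cxy /=.
apply/card_le1_eqP => x y; rewrite !inE => /andP[xe /eqP cx] /andP[ye /eqP cy].
by have /forall_inP/(_ y ye) := inj x xe; rewrite cx cy eqxx => /eqP.
Qed.

(** * Extremal [F32]-free 3-graphs *)

Section F32Free.

Variables (T : finType) (H : graph3 T).
Hypothesis T_gt0 : 0 < #|T|.
Hypothesis H_free : is_free F32 H.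
Hypothesis card_le : #|T| <= 2 * pos_codeg H.

(** Since [card_le] is only an inequality, this serves both for the upper bound, by contradiction,
    and for the case of equality. *)
Theorem F32_free_extremal :
  #|T| = 2 * pos_codeg H /\ 4 %| #|T| /\ is_complete_balanced_4partite H.
Proof.
(* As [T] is nonempty, [card_le] makes [pos_codeg H] positive, which rules out the edgeless case. *)
have [|u [v [w uvw]]] := @pos_codeg_edge _ H; first by lia.
have edge3 x y z : [set x; y; z] \in edges H -> [&& x != y, x != z & y != z].
  by rewrite -cards3E => xyz; case: H xyz => E /= /forall_inP; apply.
pose tri x y z := [set x; y; z] \in edges H.
have swap12 x y z : tri x y z = tri y x z by rewrite /tri (setUC [set x]).
have swap23 x y z : tri x y z = tri x z y by rewrite /tri setUAC.
have irr x z : ~~ tri x x z by apply/negP => /edge3; rewrite eqxx.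
have free a b x y z : tri a b x -> tri a b y -> tri a b z -> ~~ tri x y z.
  move=> abx aby abz; apply/negP => xyz.
  by move/negP: H_free; apply; apply: F32_copy abx aby abz xyz.
have codeg_ge x y z : tri x y z -> pos_codeg H <= #|nbhd tri x y|.
  move=> xyz; have /and3P[xy _ _] := edge3 _ _ _ xyz.
  apply: leq_trans (codeg_le_nbhd H xy); apply: pos_codeg_le.
  rewrite /covered_pair cards2 xy /=; apply/exists_inP.
  by exists [set x; y; z] => //; apply: subsetUl.
have [cT _] := card_nbhd swap12 swap23 irr free codeg_ge card_le uvw.
have [c [d [kd cd tri_c]]] :=
  nbhd_free_4partite swap12 swap23 irr free codeg_ge card_le uvw.
split=> //; split; first by apply/dvdnP; exists d; lia.
have c4 : #|{: bool * bool}| = 4 by rewrite card_prod card_bool.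
(* [f] is a bijection from the four pairs of booleans to the colours in ['I_4]. *)
pose f p : 'I_4 := cast_ord c4 (enum_rank p).
have f_inj : injective f by move=> p q /cast_ord_inj/enum_rank_inj.
have f_onto i : i = f (enum_val (cast_ord (esym c4) i)).
  by rewrite /f enum_valK cast_ordKV.
exists (f \o c); split.
  have class_card i : #|color_class (f \o c) i| = d.
    rewrite -(cd (enum_val (cast_ord (esym c4) i))) {1}(f_onto i).
    by apply: eq_card => x; rewrite !inE /= (inj_eq f_inj).
  by move=> i j; rewrite !class_card leq_addr.
apply/setP => e; rewrite inE color_class_le1.
have [e3 | ne3] := boolP (#|e| == 3); last first.
  by apply: contraNF ne3 => eH; case: H eH => E /= /forall_inP; apply.
have [x [y [z exyz]]] := cards3_ex (eqP e3).
have /and3P[xy xz yz] : [&& x != y, x != z & y != z] by rewrite -cards3E -exyz.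
rewrite exyz -/(tri x y z) tri_c /=; apply/and3P/forall_inP => [[cxy cxz cyz] s|inj].
  have [cyx czx czy] : [/\ c y != c x, c z != c x & c z != c y].
    by rewrite eq_sym cxy eq_sym cxz eq_sym cyz.
  pose neqs := (negbTE cxy, negbTE cxz, negbTE cyz, negbTE cyx, negbTE czx, negbTE czy).
  rewrite !inE -orbA => /or3P[] /eqP->; apply/forall_inP => t;
  by rewrite !inE -orbA => /or3P[] /eqP->; rewrite (inj_eq f_inj) ?neqs ?eqxx.
have ne s t : s \in [set x; y; z] -> t \in [set x; y; z] -> s != t -> c s != c t.
  move=> se te; apply: contraNneq => cst.
  by have /forall_inP/(_ t te) := inj s se; rewrite /= cst eqxx.
by split; apply: ne; rewrite ?inE ?eqxx ?orbT.
Qed.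

End F32Free.

Theorem theorem8 (n : nat) (n_gt0 : 0 < n) :
  ((co_pos_ex n F32)%:R <= n%:R / 2%:R :> rat)%R /\
  (forall (T : finType) (H : graph3 T),
     #|T| = n ->
     is_free F32 H ->
     ((pos_codeg H)%:R = n%:R / 2%:R :> rat)%R ->
     4 %| n /\ is_complete_balanced_4partite H).
Proof.
have two_gt0 : (0 < 2%:R :> rat)%R by [].
split.
  rewrite Num.Theory.ler_pdivlMr // -GRing.natrM Num.Theory.ler_nat mulnC.
  (* A value above [n./2] satisfies [card_le], yet the resulting equality [n = 2 * pos_codeg H]
     contradicts it. *)
  have le_half (H : graph3 'I_n) : is_free F32 H -> pos_codeg H <= n./2.
    move=> H_free; rewrite leqNgt; apply/negP => half_lt.
    have [||eq_n _] := F32_free_extremal _ H_free; rewrite ?card_ord; try lia.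
    by move: eq_n; rewrite card_ord; lia.
  by have /bigmax_leqP := le_half; rewrite -/(co_pos_ex n F32); lia.
move=> T H cT H_free Hk.
have kn : pos_codeg H * 2 = n.
  apply/eqP; rewrite -(Num.Theory.eqr_nat rat) GRing.natrM Hk GRing.divfK //.
by have [||_ []] := F32_free_extremal _ H_free; rewrite ?cT ?kn; try lia.
Qed.
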